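(* Every torsion-free finitely generated nilpotent group is square absolutely continuous.
   Context: A left Følner sequence in a countable group $G$ is a sequence $\Phi=(\Phi_N)_{N\in\mathbb{N}}$ of finite (nonempty) subsets of $G$ with $\lim_{N\to\infty}|g\Phi_N\cap\Phi_N|/|\Phi_N|=1$ for every $g\in G$. $G$ is amenable if it admits a left Følner sequence. An amenable group $G$ is square absolutely continuous if it admits two left Følner sequences $\Phi=(\Phi_N)_{N}$ and $\Psi=(\Psi_N)_{N}$ such that: for any $\varepsilon>0$ there exists $\delta>0$ such that for any $u:G\to[0,1]$ with $\limsup_{N\to\infty}\frac{1}{|\Phi_N|}\sum_{g\in\Phi_N}u(g)<\delta$ we have $\limsup_{N\to\infty}\frac{1}{|\Psi_N|}\sum_{g\in\Psi_N}u(g^2)<\varepsilon$. *)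

(* Defs.v *)
From mathcomp Require Import all_boot all_order all_algebra.
From mathcomp Require Import finmap.
From mathcomp Require Import all_classical all_reals all_analysis.

Set Implicit Arguments.
Unset Strict Implicit.
Unset Printing Implicit Defensive.

Import Order.TTheory GRing.Theory Num.Theory.
Import numFieldNormedType.Exports.

Local Open Scope classical_set_scope.
Local Open Scope ring_scope.

Section GroupNotions.
Variable G : groupType.

Definition is_subgroup (H : set G) : Prop :=
  [/\ H 1%g,
      forall x y, H x -> H y -> H (x * y)%g
    & forall x, H x -> H (x^-1)%g].

Definition subgroup_gen (A : set G) : set G := smallest is_subgroup A.

Definition finitely_generated : Prop :=
  exists S : {fset G}, subgroup_gen [set` S] = [set: G].

Definition torsion_free : Prop :=
  forall (x : G) (n : nat), (0 < n)%N -> (x ^+ n)%g = 1%g -> x = 1%g.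

(* The indexing starts at [lower_central 0 = G]. *)
Fixpoint lower_central (n : nat) : set G :=
  if n is m.+1 then
    subgroup_gen [set [~ x, y]%g | x in lower_central m & y in [set: G]]
  else [set: G].

Definition nilpotent_group : Prop :=
  exists n, lower_central n = [set 1%g].

End GroupNotions.

Arguments finitely_generated : clear implicits.
Arguments torsion_free : clear implicits.
Arguments nilpotent_group : clear implicits.

Section SquareAbsolutelyContinuous.
Variables (R : realType) (G : groupType).

Definition left_Folner (Phi : nat -> {fset G}) : Prop :=
  (forall N, Phi N != fset0) /\
  (forall g : G,
     (#|` ([fset (g * h)%g | h in Phi N] `&` Phi N)%fset |%:R
        / #|` Phi N|%:R : R) @[N --> \oo] --> (1 : R)).

Definition amenable : Prop :=
  countable [set: G] /\ exists Phi : nat -> {fset G}, left_Folner Phi.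

Definition average (A : {fset G}) (u : G -> R) : R :=
  (#|` A|%:R)^-1 * \sum_(g <- A) u g.

Definition square_absolutely_continuous : Prop :=
  amenable /\
  exists Phi Psi : nat -> {fset G},
    [/\ left_Folner Phi, left_Folner Psi
      & forall eps : R, 0 < eps ->
        exists2 delta : R, 0 < delta &
          forall u : G -> R, (forall g, 0 <= u g <= 1) ->
            (limn_esup (fun N => (average (Phi N) u)%:E) < delta%:E)%E ->
            (limn_esup (fun N =>
               (average (Psi N) (fun g => u (g ^+ 2)%g))%:E) < eps%:E)%E].

End SquareAbsolutelyContinuous.

(* Main.v *)
(** The Følner sequences are balls [T^N] for a finite symmetric generating set
    [T] containing [1].  Squaring maps the ball of radius [r] into the ball of
    radius [2 r], and it is injective because [G] is torsion-free nilpotent.  So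
    the average of [u (g ^ 2)] over the ball of radius [r] is at most [C] times
    the average of [u] over the ball of radius [s], provided [2 r <= s] and the
    ratio of the cardinals of the two balls is at most [C].  A nilpotent group
    has polynomial growth, so that at infinitely many scales [n] the balls of
    radii [n] and [8 n] have comparable cardinals; by pigeonhole one then finds
    [r] in [[n, 2 n]] and [s] in [[4 n, 5 n]] near which the growth is flat,
    which makes both sequences of balls Følner. *)
Require Import Defs.
From mathcomp Require Import all_boot all_order all_algebra.
From mathcomp Require Import finmap.
From mathcomp Require Import all_classical all_reals all_analysis.
From mathcomp Require Import zify lra.

Set Implicit Arguments.
Unset Strict Implicit.
Unset Printing Implicit Defensive.

Import Order.TTheory GRing.Theory Num.Theory.

Lemma leq_expl d m n : (m <= n -> m ^ d <= n ^ d)%N.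
Proof. by case: d => // d; rewrite leq_exp2r. Qed.

Section Nilpotent.
Local Open Scope nat_scope.
Local Open Scope group_scope.
Variable G : groupType.
Implicit Types (x y z g : G) (L s t : seq G) (T : {fset G}).

(** * Lower central series and square roots *)

Lemma lower_central_subgroup n : is_subgroup (@lower_central G n).
Proof.
case: n => [|n] //=; split=> [H [[H1 _ _] _] //|x y Hx Hy H HH|x Hx H HH].
  by case: (HH) => -[_ HM _] _; apply: HM; [exact: Hx | exact: Hy].
by case: (HH) => -[_ _ HV] _; apply: HV; exact: Hx.
Qed.

Lemma lower_centralR n x y : lower_central n x -> lower_central n.+1 [~ x, y].
Proof. by move=> nx H [_]; apply; exists x => //; exists y. Qed.

(* If [z = x c] with [c] in the [j]-th term of the lower central series, then
   [x] and [x ^ z] differ by an element of the next term and still have the same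
   square, so that [x] commutes with [z] by induction. *)
Lemma square_inj : torsion_free G -> nilpotent_group G ->
  injective (fun x : G => x ^+ 2).
Proof.
move=> tfG [n nilG] x z.
suff sq k j : (k + j = n)%N ->
    forall x z, lower_central j (x^-1 * z) -> x ^+ 2 = z ^+ 2 -> x = z.
  by apply: (sq n 0%N); rewrite ?addn0.
elim: k j => [|k IHk] j => [jn|kj] {}x {}z.
  by rewrite -[j]add0n jn nilG => /mulg1_eq; rewrite invgK.
move=> jxz xz.
have xxz : x = x ^ z.
  apply: (IHk j.+1); first by rewrite addnS -addSn.
    rewrite -commgEl -invgR; have [_ _ V] := lower_central_subgroup j.+1.
    apply: (V).
    (* The factor [x^-1] commutes with [x], so it does not affect the commutator. *)
    have -> : [~ z, x] = [~ x^-1 * z, x].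
      by rewrite !commgEl !conjgE !invgM invgK !mulgA !mulgK.
    exact: lower_centralR.
  by rewrite -conjXg xz conjXg conjgE mulKg.
have xz_comm : commute x z by rewrite /commute [LHS]conjgC -xxz.
(* Since [x] and [z] commute, [(z / x) ^+ 2 = z ^+ 2 / x ^+ 2 = 1]. *)
apply/eqP; rewrite eq_sym -divg_eq1; apply/eqP; apply: (tfG _ 2) => //.
by rewrite expgnFl ?xz ?mulgV //; exact: commute_sym.
Qed.

(** * Words, collection and polynomial growth *)

Definition prods s : G := foldr *%g 1 s.

Lemma prods_cat s t : prods (s ++ t) = prods s * prods t.
Proof. by elim: s => [|x s IHs] /=; rewrite ?mul1g // IHs mulgA. Qed.

(** Inverses of letters are excluded: collection only conjugates by nonnegative powers. *)
Definition word L N g :=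
  exists s, [/\ {subset s <= L}, (size s <= N)%N & g = prods s].

Lemma word1 L N : word L N 1.
Proof. by exists [::]. Qed.

Lemma wordM L N M g h : word L N g -> word L M h -> word L (N + M) (g * h).
Proof.
move=> [s [sL sN ->]] [t [tL tN ->]]; exists (s ++ t); split.
- by move=> x; rewrite mem_cat => /orP[/sL|/tL].
- by rewrite size_cat leq_add.
- by rewrite prods_cat.
Qed.

Lemma word_le L N M g : (N <= M)%N -> word L N g -> word L M g.
Proof.
by move=> NM [s [sL sN ->]]; exists s; split=> //; exact: leq_trans NM.
Qed.

Lemma word_sub L L' N g : {subset L <= L'} -> word L N g -> word L' N g.
Proof. by move=> LL' [s [sL sN ->]]; exists s; split=> // x /sL /LL'. Qed.

Lemma word_letter L y : y \in L -> word L 1 y.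
Proof.
by move=> yL; exists [:: y]; split=> [z||]; rewrite /prods /= ?mulg1 // inE => /eqP->.
Qed.

Section Collection.
Variables (n : nat) (nilG : @lower_central G n = [set 1]%classic).
Variables (x : G) (L : seq G).
Hypothesis Lx : forall y, y \in L -> [~ y, x] = 1 \/ [~ y, x] \in L.

(* [y ^ x ^+ a.+1] is the product of [y ^ x ^+ a] and [[~ y, x] ^ x ^+ a], where
   [[~ y, x]] is one step deeper in the lower central series. *)
Lemma word_conjX d a y : y \in L -> lower_central (n - d) y ->
  word L (a.+1 ^ d)%N (y ^ (x ^+ a)).
Proof.
elim: d a y => [|d IHd] a y yL.
  by rewrite subn0 nilG => ->; rewrite conj1g; exact: word1.
move=> ny; elim: a => [|a IHa]; first by rewrite exp1n conjg1; exact: word_letter.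
have -> : y ^ (x ^+ a.+1) = y ^ (x ^+ a) * [~ y, x] ^ (x ^+ a).
  by rewrite -conjMg commgEl mulVKg -conjgM expgS.
have R : word L (a.+1 ^ d)%N ([~ y, x] ^ (x ^+ a)).
  have [->|yxL] := Lx yL; first by rewrite conj1g; exact: word1.
  apply: IHd => //; have := lower_centralR x ny.
  case: (leqP d.+1 n) => dn; first by rewrite -subSn // subSS.
  (* Truncated subtraction: both indices are 0, where the series is the whole group. *)
  have [-> ->] : n - d.+1 = 0%N /\ n - d = 0%N by lia.
  by [].
apply: word_le (wordM IHa R); rewrite expnS -mulSnr expnS; apply: leq_mul => //.
exact: leq_expl.
Qed.

(* A letter [y] standing before the [a] copies of [x] already collected becomes
   [y ^ x ^+ a] when it is moved behind them. *)
Lemma collect N g : word (x :: L) N g ->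
  exists a w, [/\ (a <= N)%N, word L (N * N.+1 ^ n) w & g = x ^+ a * w].
Proof.
move=> [s [sL sN ->]].
have : exists a w, [/\ (a <= size s)%N, word L (size s * (size s).+1 ^ n) w
    & prods s = x ^+ a * w].
  elim: s sL {sN} => [|y s IHs] sL.
    by exists 0%N, 1; split=> //; [exact: word1 | rewrite mul1g].
  have [z zs|/= a [w [aN wL ->]]] := IHs; first by apply: sL; rewrite inE zs orbT.
  have /[!inE]/predU1P[->|yL] := sL y (mem_head _ _).
    exists a.+1, w; split=> //; last by rewrite expgS mulgA.
    by apply: word_le wL; rewrite leq_mul // leq_expl.
  exists a, (y ^ (x ^+ a) * w); split; [exact: leqW| |].
    have yx : word L (a.+1 ^ n)%N (y ^ (x ^+ a)).
      by apply: word_conjX; rewrite ?subnn.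
    apply: word_le (wordM yx wL) => /=.
    rewrite mulSn leq_add //; first by rewrite leq_expl //; lia.
    by rewrite leq_mul // leq_expl.
  by rewrite mulgA [y * _]conjgC -mulgA.
move=> [a [w [aN wL ->]]]; exists a, w; split=> //; first exact: leq_trans sN.
by apply: word_le wL; rewrite leq_mul // leq_expl.
Qed.

End Collection.

(** Collecting the head then leaves a word in the tail alone. *)
Fixpoint commutator_closed L :=
  if L is x :: L' then
    (forall y, y \in L' -> [~ y, x] = 1 \/ [~ y, x] \in L')
      /\ commutator_closed L'
  else True.

(** Collecting the head leaves at most [N.+1] exponents and a word of length at most [N.+1 ^ n.+1]
    in the tail, so the degree passes from [d] to [n.+1 * d + 1]. *)
Lemma word_growth L : nilpotent_group G -> commutator_closed L ->
  exists d, forall N, exists2 t, (size t <= N.+1 ^ d)%N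
    & forall g, word L N g -> g \in t.
Proof.
move=> [n nilG]; elim: L => [_|x L IHL /= [Lx /IHL[d growth]]].
  exists 0%N => N; exists [:: 1] => // g [[|x s] [sL _ ->]]; first by rewrite inE.
  by have := sL x (mem_head _ _).
exists (n.+1 * d).+1 => N; have [t tN Lt] := growth (N * N.+1 ^ n)%N.
exists [seq x ^+ a * w | a <- iota 0 N.+1, w <- t].
  rewrite size_allpairs size_iota expnS leq_mul //; apply: leq_trans tN _.
  rewrite expnM; apply: leq_expl.
  by rewrite expnS mulSn addnC -addn1 leq_add // expn_gt0.
move=> g /(collect nilG Lx)[a [w [aN /Lt wt ->]]].
by apply/allpairsP; exists (a, w); rewrite mem_iota.
Qed.

Lemma commutator_closed_cat s L : commutator_closed L ->
  (forall x y, x \in s -> y \in s ++ L -> [~ y, x] = 1 \/ [~ y, x] \in L) ->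
  commutator_closed (s ++ L).
Proof.
move=> cL; elim: s => //= x s IHs sL; split=> [y ysL|].
  have [||->|yxL] := sL x y; rewrite ?inE ?eqxx ?ysL ?orbT //; first by left.
  by right; rewrite mem_cat yxL orbT.
by apply: IHs => y z ys zsL; apply: sL; rewrite inE ?ys ?zsL orbT.
Qed.

Section Letters.
Variable s : seq G.

(* First component: the commutators of level exactly [k]; second component: those
   of all levels at most [k]. *)
Fixpoint letters k : seq G * seq G :=
  if k is k'.+1 then
    let A := [seq [~ y, x] | y <- (letters k').1, x <- (letters k').2] in
    (A, (letters k').2 ++ A)
  else (s, s).

Lemma letters_sub i j : (i <= j)%N -> {subset (letters i).1 <= (letters j).2}.
Proof.
move=> + x; elim: j => [|j IHj]; first by case: i.
rewrite leq_eqVlt => /predU1P[->/=|/IHj IH /IH] xj; rewrite mem_cat ?xj //.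
by rewrite orbT.
Qed.

Lemma letters_lower_central k x : x \in (letters k).1 -> lower_central k x.
Proof.
elim: k x => // k IHk x /allpairsP[[y z] /= [/IHk ky _ ->]].
exact: lower_centralR.
Qed.

(** List the iterated commutators by increasing level: that of a letter of level [j] with one of
    level at most [j] has level [j.+1], hence comes later, and level [n] is trivial. *)
Lemma commutator_closed_letters n : @lower_central G n = [set 1]%classic ->
  exists2 L, commutator_closed L & {subset s <= L}.
Proof.
move=> nilG.
pose T k m := flatten [seq (letters j).1 | j <- iota k m].
exists (T 0%N n.+1); last by move=> x; rewrite mem_cat => ->.
have : (0 + n.+1 = n.+1)%N by [].
elim: {1 3}n.+1 0%N => [|m IHm] k km //.
rewrite /T /=; apply: commutator_closed_cat; first by apply: IHm; lia.
move=> x y xk; rewrite -[_ ++ _]/(T k m.+1) => /flatten_mapP[j].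
rewrite mem_iota => /andP[kj jkm] yj.
have [nj|jn] := leqP n j.
  have -> : y = 1.
    have := letters_lower_central yj.
    have -> : j = n by lia.
    by rewrite nilG.
  by left; rewrite comm1g.
right; apply/flatten_mapP; exists j.+1; first by rewrite mem_iota; lia.
by apply/allpairsP; exists (y, x); split=> //; exact: letters_sub kj _ _.
Qed.

End Letters.

(** * Balls in a finitely generated group *)

Fixpoint ball T N : {fset G} :=
  if N is N'.+1 then [fset x * y | x in T, y in ball T N']%fset
  else [fset 1]%fset.

Lemma ball_word T N g : g \in ball T N -> word (enum_fset T) N g.
Proof.
elim: N g => [|N IHN] g /=; first by rewrite inE => /eqP->; exact: word1.
move=> /imfset2P[x xT [y /IHN yN ->]]; rewrite -add1n; apply: wordM yN.
exact: word_letter.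
Qed.

Lemma ball_growth T : nilpotent_group G ->
  exists d, forall N, (#|` ball T N| <= N.+1 ^ d)%N.
Proof.
move=> nilG; have [n nilGn] := nilG.
have [L cL TL] := commutator_closed_letters (enum_fset T) nilGn.
have [d growth] := word_growth nilG cL.
exists d => N; have [t tN Lt] := growth N.
apply: leq_trans tN; apply: uniq_leq_size; first exact: fset_uniq.
by move=> g /ball_word /(word_sub TL) /Lt.
Qed.

Lemma ballM T N M x y :
  x \in ball T N -> y \in ball T M -> x * y \in ball T (N + M).
Proof.
elim: N x => [|N IHN] x /=; first by rewrite inE => /eqP->; rewrite mul1g.
move=> /imfset2P[z zT [w /IHN wN ->]] /wN wyN.
by apply/imfset2P; exists z => //; exists (w * y); rewrite ?mulgA.
Qed.

Lemma ball_leq T N M : 1 \in T -> (N <= M)%N -> (ball T N `<=` ball T M)%fset.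
Proof.
move=> T1; elim: M => [|M IHM]; first by case: N.
rewrite leq_eqVlt => /predU1P[->//|/IHM NM].
apply/fsubsetP => x /(fsubsetP NM) xM.
by apply/imfset2P; exists 1 => //; exists x; rewrite ?mul1g.
Qed.

Lemma ball1 T N : 1 \in T -> 1 \in ball T N.
Proof. by move=> T1; apply: (fsubsetP (ball_leq T1 (leq0n N))); rewrite inE. Qed.

(** Adjoining 1 and the inverses to the generators makes the union of the balls a subgroup. *)
Lemma ball_cover : finitely_generated G ->
  exists2 T : {fset G}, 1 \in T & forall g, exists N, g \in ball T N.
Proof.
move=> [S genS]; pose T := (1 |` (S `|` [fset x^-1 | x in S]))%fset.
have T1 : 1 \in T by rewrite !inE eqxx.
have TV x : x \in T -> x^-1 \in T.
  rewrite !inE => /orP[/eqP->|/orP[xS|/imfsetP[y yS ->]]].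
  - by rewrite invg1 eqxx.
  - by apply/orP; right; apply/orP; right; apply/imfsetP; exists x.
  - by rewrite invgK [y \in S]yS orbT.
have sub1 x : x \in T -> x \in ball T 1.
  by move=> xT; apply/imfset2P; exists x => //; exists 1; rewrite ?inE ?mulg1.
exists T => // g; have : [set: G]%classic g by [].
rewrite -genS => /(_ [set x | exists N, x \in ball T N]%classic); apply.
split; last first.
  by move=> x xS; exists 1%N; apply: sub1; rewrite !inE [x \in S]xS orbT.
split; first by exists 0%N; rewrite inE.
  by move=> x y [N xN] [M yM]; exists (N + M)%N; exact: ballM.
move=> x [N]; elim: N x => [|N IHN] x.
  by rewrite inE => /eqP->; exists 0%N; rewrite inE invg1.
move=> /imfset2P[y yT [z /IHN[M zM] ->]]; exists (M + 1)%N; rewrite invgM.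
by apply: ballM => //; apply/sub1/TV.
Qed.

End Nilpotent.

(** * Scales at which a polynomially bounded function is flat *)

(* Otherwise [k * f] would grow by more than [f n] at each of the [m >= k * C]
   steps of the arithmetic progression from [a] to [a + k * m]. *)
Lemma flat_step (f : nat -> nat) k n a C m : {homo f : i j / i <= j}%N ->
  (0 < k)%N -> (0 < f n)%N -> (n <= a)%N -> (k * C <= m)%N -> (f (a + k * m) <= C * f n)%N ->
  exists2 r, (a <= r /\ r + k <= a + k * m)%N
    & (k * f (r + k) <= k * f r + f (r + k))%N.
Proof.
move=> f_mono k0 fn na kCm fC; apply: contrapT => H.
have step i : (i < m)%N -> (k * f (a + k * i) + f n < k * f (a + k * i.+1))%N.
  move=> im; rewrite ltnNge; apply/negP => le; apply: H.
  exists (a + k * i)%N; first by nia.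
  rewrite -addnA -mulnSr; apply: leq_trans le _; rewrite leq_add2l.
  by apply: f_mono; nia.
have sum i : (i <= m)%N -> (k * f a + i * f n <= k * f (a + k * i))%N.
  elim: i => [|i IHi] im; first by rewrite muln0 addn0; lia.
  by have := step i im; have := IHi (ltnW im); lia.
(* The contradiction needs [0 < f a], which follows from [0 < f n]. *)
have fa := f_mono _ _ na.
have := sum m (leqnn m).
have : (k * f (a + k * m) <= m * f n)%N.
  by apply: leq_trans (leq_mul (leqnn k) fC) _; rewrite mulnA leq_mul.
by nia.
Qed.

(** Otherwise every factor 8 in the scale multiplies [f] by more than [2 * 8 ^ d], which beats
    growth of degree [d] by a factor [2 ^ i] after [i] steps. *)
Lemma tame_scale (f : nat -> nat) d : (forall n, 0 < f n <= n.+1 ^ d)%N ->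
  forall k j0, (0 < k)%N -> exists2 j, (j0 <= j)%N
    & (f (8 * (k * 8 ^ j)) <= 2 * 8 ^ d * f (k * 8 ^ j))%N.
Proof.
move=> f_poly k j0 k0; apply: contrapT => H.
have grow i : ((2 * 8 ^ d) ^ i <= f (k * 8 ^ (j0 + i)))%N.
  elim: i => [|i IHi]; first by rewrite addn0; case/andP: (f_poly (k * 8 ^ j0)%N).
  rewrite addnS [X in (k * X)%N]expnS mulnCA expnS; 
  apply: leq_trans (leq_mul (leqnn _) IHi) _.
  rewrite leqNgt; apply/negP => lt; apply: H; exists (j0 + i)%N; [lia | exact: ltnW].
pose K := ((2 * k * 8 ^ j0) ^ d)%N.
have le i : (2 ^ i <= K)%N.
  have p8 : (0 < (8 ^ d) ^ i)%N by rewrite !expn_gt0.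
  rewrite -(leq_pmul2r p8) -expnMn; apply: leq_trans (grow i) _.
  have /andP[_] := f_poly (k * 8 ^ (j0 + i))%N; move/leq_trans; apply.
  rewrite /K -expnM [(d * i)%N]mulnC expnM -expnMn; apply: leq_expl.
  have : (0 < k * 8 ^ (j0 + i))%N by rewrite muln_gt0 k0 expn_gt0.
  by rewrite expnD; lia.
by have := ltn_expl K (isT : (1 < 2)%N); rewrite ltnNge le.
Qed.

Lemma Folner_radii (f : nat -> nat) d : {homo f : i j / i <= j}%N ->
  (forall n, 0 < f n <= n.+1 ^ d)%N ->
  exists C, forall k, (0 < k)%N -> exists r s,
    [/\ (2 * (r + k) <= s + k)%N, (f (s + k) <= C * f (r + k))%N,
        (k * f (r + k) <= k * f r + f (r + k))%N
      & (k * f (s + k) <= k * f s + f (s + k))%N].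
Proof.
move=> f_mono f_poly; exists (2 * 8 ^ d)%N => k k0; set C := (2 * _)%N.
(* Starting at [j0 = k * C] forces [8 ^ j >= k * C], so that [8 ^ j] steps of length [k], of total
   length [n], suffice for [flat_step]. *)
have [j jC] := tame_scale f_poly (k * C) k0; set n := (k * 8 ^ j)%N => nC.
have jm : (k * C <= 8 ^ j)%N by apply: leq_trans jC (ltnW (ltn_expl _ _)).
have fn : (0 < f n)%N by case/andP: (f_poly n).
have [|r [nr rn] fr] := flat_step f_mono k0 fn (leqnn n) jm.
  by apply: leq_trans nC; apply: f_mono; lia.
have n4 : (n <= 4 * n)%N by lia.
have [|s [ns sn] fs] := flat_step f_mono k0 fn n4 jm.
  by apply: leq_trans nC; apply: f_mono; lia.
exists r, s; split => //; first lia.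
have nr_f : (C * f n <= C * f (r + k))%N by rewrite leq_mul // f_mono; lia.
by apply: leq_trans nr_f; apply: leq_trans nC; apply: f_mono; lia.
Qed.

(** * Følner sequences of balls and averages *)

Section Averages.
Import numFieldNormedType.Exports.
Local Open Scope classical_set_scope.
Local Open Scope ring_scope.
Variables (R : realType) (G : groupType).

Lemma left_Folner_ball (T : {fset G}) (r : nat -> nat) : 1%g \in T ->
  (forall g, exists N, g \in ball T N) ->
  (forall N, N.+1 * #|` ball T (r N + N.+1)|
     <= N.+1 * #|` ball T (r N)| + #|` ball T (r N + N.+1)|)%N ->
  left_Folner R (fun N => ball T (r N + N.+1)).
Proof.
move=> T1 cover flat; split=> [N|g].
  by apply/fset0Pn; exists 1%g; exact: ball1.
have [m gm] := cover g.
apply: (@squeeze_cvgr _ _ _ _ (fun N => 1 - harmonic N) (fun=> 1)); last first.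
- exact: cvg_cst.
- by rewrite -[X in _ --> X]subr0; apply: cvgB; [exact: cvg_cst|exact: cvg_harmonic].
near=> N.
have mN : (m <= N)%N by near: N; exact: nbhs_infty_ge.
set B := ball T (r N + N.+1).
have B0 : 0 < #|` B|%:R :> R.
  by rewrite ltr0n cardfs_gt0; apply/fset0Pn; exists 1%g; exact: ball1.
apply/andP; split; last first.
  by rewrite ler_pdivrMr // mul1r ler_nat fsubset_leq_card // fsubsetIr.
rewrite ler_pdivlMr // mulrBl mul1r lerBlDr.
(* The translate by [g] of the inner ball lies in both [g B] and [B], as the margin [N.+1] exceeds
   the length of [g]. *)
have card_le : (#|` ball T (r N)| <= #|` ([fset (g * h)%g | h in B] `&` B)%fset|)%N.
  have <- : #|` [fset (g * h)%g | h in ball T (r N)]%fset| = #|` ball T (r N)|.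
    by rewrite card_imfset //; exact: mulgI.
  apply: fsubset_leq_card.
  apply/fsubsetP => _ /imfsetP[h /= hr ->]; rewrite inE; apply/andP; split.
    apply/imfsetP; exists h => //=; apply: (fsubsetP (ball_leq T1 _)) hr; lia.
  by apply: (fsubsetP (ball_leq T1 _)) (ballM gm hr); lia.
rewrite /harmonic /= -(ler_pM2l (ltr0Sn R N)) mulrDr mulVKf ?pnatr_eq0 //.
rewrite -!natrM -natrD ler_nat; apply: leq_trans (flat N) _.
by rewrite leq_add2r leq_mul.
Unshelve. all: by end_near.
Qed.

(** Reindexing along the injection [f] turns the sum over [A] into part of a sum of nonnegative
    terms over [B]. *)
Lemma average_comp (A B : {fset G}) (f : G -> G) (C : nat) (u : G -> R) :
  injective f -> (forall x, x \in A -> f x \in B) -> A != fset0 ->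
  (#|` B| <= C * #|` A|)%N -> (forall x, 0 <= u x) ->
  average A (u \o f) <= C%:R * average B u.
Proof.
move=> f_inj fAB A0 BA u0; rewrite /average.
have cA : (0 < #|` A|)%N by rewrite cardfs_gt0.
have cB : (0 < #|` B|)%N.
  rewrite cardfs_gt0; have /fset0Pn[x xA] := A0.
  by apply/fset0Pn; exists (f x); exact: fAB.
have le : \sum_(g <- A) u (f g) <= \sum_(g <- B) u g.
  have -> : \sum_(g <- A) u (f g) = \sum_(g <- [fset f x | x in A]%fset) u g.
    by rewrite big_imfset //= => x y _ _ /f_inj.
  have sub : ([fset f x | x in A] `<=` B)%fset.
    by apply/fsubsetP => _ /imfsetP[x /= xA ->]; exact: fAB.
  rewrite [leRHS](big_fsetID _ (mem [fset f x | x in A]%fset)) /=.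
  rewrite ler_wpDr ?sumr_ge0 // le_eqVlt; apply/orP; left; apply/eqP.
  apply: eq_fbigl => x; rewrite !inE /=; apply/idP/andP => [xI|[]//].
  by split; first exact: (fsubsetP sub).
rewrite mulrA; apply: ler_pM => //; [by apply: sumr_ge0 => x _; exact: u0|].
rewrite -[leLHS]mul1r ler_pdivrMr ?ltr0n // mulrAC ler_pdivlMr ?ltr0n //.
by rewrite mul1r -natrM ler_nat.
Qed.

Lemma limn_esup_transfer (v w : nat -> R) (eps C : R) : 0 < eps -> 0 < C ->
  (forall N, w N <= C * v N) ->
  (limn_esup (EFin \o v) < (eps / (2 * C))%:E)%E ->
  (limn_esup (EFin \o w) < eps%:E)%E.
Proof.
move=> eps0 C0 wv; rewrite /limn_esup /limf_esup.
move=> /ereal_inf_lt[_ [V FV <-]] Veps.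
(* Bounding a supremum termwise gives only a weak inequality; the spare factor 2 makes it strict. *)
apply: (@le_lt_trans _ _ (eps / 2)%:E); last by rewrite lte_fin; lra.
apply: ge_ereal_inf; exists (ereal_sup [set (EFin \o w) x | x in V]).
  by exists V.
apply: ge_ereal_sup => _ [N VN <-] /=; rewrite lee_fin.
apply: le_trans (wv N) _.
rewrite mulrC -ler_pdivlMr // -lee_fin -mulrA -invfM; apply: le_trans (ltW Veps).
by apply: ereal_sup_ubound; exists N.
Qed.

End Averages.

Theorem theorem1p8 (R : realType) (G : groupType)
  (G_torsion_free : torsion_free G)
  (G_finitely_generated : finitely_generated G)
  (G_nilpotent : nilpotent_group G) :
  square_absolutely_continuous R G.
Proof.
have [T T1 cover] := ball_cover G_finitely_generated.
have [d growth] := ball_growth T G_nilpotent.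
have mono : {homo (fun N => #|` ball T N|) : i j / i <= j}%N.
  by move=> i j ij; exact/fsubset_leq_card/ball_leq.
have [|C radii] := Folner_radii (d := d) mono.
  move=> n; rewrite growth andbT cardfs_gt0.
  by apply/fset0Pn; exists 1%g; exact: ball1.
(* With [k = N.+1] the flatness defect is [1 / N.+1], which tends to 0. *)
have {radii} radiiS N := radii N.+1 isT.
have [r /choice[s rs]] := choice radiiS.
have Folner_r : left_Folner R (fun N => ball T (r N + N.+1)).
  by apply: left_Folner_ball => // N; case: (rs N).
have Folner_s : left_Folner R (fun N => ball T (s N + N.+1)).
  by apply: left_Folner_ball => // N; case: (rs N).
split.
  split; last by exists (fun N => ball T (r N + N.+1)).
  have -> : [set: G]%classic = (\bigcup_N [set` ball T N])%classic.
    by apply/seteqP; split=> // g _; have [N gN] := cover g; exists N.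
  by apply: bigcup_countable => // N _; exact/finite_set_countable.
(* The larger balls come first, since they must contain the squares of the smaller ones. *)
exists (fun N => ball T (s N + N.+1)), (fun N => ball T (r N + N.+1)).
split=> // eps eps0.
have C0 : (0 < C%:R :> R)%R.
  rewrite ltr0n lt0n; apply/eqP => C0; have [_ + _ _] := rs 0%N.
  rewrite C0 mul0n leqn0 cardfs_eq0; apply/negP/fset0Pn.
  by exists 1%g; exact: ball1.
exists (eps / (2 * C%:R))%R; first by rewrite divr_gt0 // mulr_gt0.
move=> u u01; apply: (limn_esup_transfer eps0 C0) => N.
have [rs2 card_s _ _] := rs N.
apply: (average_comp (square_inj G_torsion_free G_nilpotent)) => //.
- move=> x xr; apply: (fsubsetP (ball_leq T1 rs2)).
  by rewrite mul2n -addnn; exact: ballM.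
- by case: Folner_r.
- by move=> x; case/andP: (u01 x).
Qed.
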